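(* Let $x\in\mathcal M_h$, $y\in\mathcal M_H$, and let $q:\mathcal C_y\to\mathbb R$ be the objective of the Riemannian coarse model, $$q(z)=f_H(z)-\langle w,\mathcal L^H_y(z)\rangle_y,\qquad w=\operatorname{grad} f_H(y)-R_x^y(\operatorname{grad} f_h(x)).$$ Let $\tilde z\in\mathcal C_y$ be such that $q(\tilde z)<q(y)$ (an approximate solution of $\min_{z\in\mathcal C_y}q(z)$), and let $$d=P_y^x\big(\mathcal L_y^H(\tilde z)\big)\in\mathrm T_x\mathcal M_h .$$ If $f_H$ is $\mathcal R^H$-convex on $\mathcal C_y$, then $$\langle\operatorname{grad} f_h(x),d\rangle_x\;\le\; q(\tilde z)-q(y)\;<\;0 .$$
   Context: Setting. $V_H,V_h$ are finite-dimensional Euclidean spaces, $\mathcal M_H\subset V_H$ (coarse) and $\mathcal M_h\subset V_h$ (fine) are Riemannian manifolds with metrics written $\langle\cdot,\cdot\rangle_y$ ($y\in\mathcal M_H$) and $\langle\cdot,\cdot\rangle_x$ ($x\in\mathcal M_h$). $f_H:\mathcal M_H\to\mathbb R$ and $f_h:\mathcal M_h\to\mathbb R$ are continuously differentiable; $\operatorname{grad}$ denotes the Riemannian gradient. Retraction and lifting. $\mathcal R^H$ is a retraction on $\mathcal M_H$: smooth maps $\mathcal R^H_y:\mathrm T_y\mathcal M_H\to\mathcal M_H$ with $\mathcal R^H_y(0)=y$, $\mathrm D\mathcal R^H_y(0)=\mathrm{id}$. The lifting map $\mathcal L^H_y=(\mathcal R^H_y)^{-1}:\mathcal U_y\to\mathrm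 T_y\mathcal M_H$ is the smooth inverse of the restriction of $\mathcal R^H_y$ to an open neighborhood of $0$ which $\mathcal R_y^H$ maps diffeomorphically onto an open neighborhood $\mathcal U_y$ of $y$. A set $\mathcal C\subset\mathcal M_H$ is $\mathcal R^H$-convex if for all $a,b\in\mathcal C$ the vector $v=\mathcal L^H_a(b)$ exists (i.e. $b\in\mathcal U_a$) and $\mathcal R^H_a(tv)\in\mathcal C$ for all $t\in[0,1]$. A function $f$ is $\mathcal R^H$-convex on such a set $\mathcal C$ if for all $a,b\in\mathcal C$ and $v=\mathcal L^H_a(b)$ the function $t\mapsto f(\mathcal R^H_a(tv))$ is convex on $[0,1]$. $\mathcal C_y\subset\mathcal M_H$ is an $\mathcal R^H$-convex set containing $y$ on which $\mathcal L_y^H$ is well defined, i.e. $\mathcal C_y\subset\mathcal U_y$. Vector transfer operators. $P_y^x:\mathrm T_y\mathcal M_H\to\mathrm T_x\mathcal M_h$ is an injective linear map (vector prolongation) and $R_x^y:\mathrm T_x\mathcal M_h\to\mathrm T_y\mathcal M_H$ is a surjective linear map (vector restriction) satisfying the geometric Galerkin condition $\langle P_y^xu,v\rangle_x=\langle u,R_x^yv\rangle_y$ for all $u\in\mathrm T_y\mathcal M_H$, $v\in\mathrm T_x\mathcal M_h$. *)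

(* Defs.v *)
From HB Require Import structures.
From mathcomp Require Import all_boot all_order all_algebra.
From mathcomp Require Import all_classical all_reals.
From mathcomp Require Import interval_inference topology normedtype derive convex.

Set Implicit Arguments.
Unset Strict Implicit.
Unset Printing Implicit Defensive.
Import Order.TTheory GRing.Theory Num.Theory.
Import numFieldNormedType.Exports.
Local Open Scope classical_set_scope.
Local Open Scope ring_scope.

(* Conventions. A Euclidean space is 'rV[R]_n; its library (max) norm induces
   the Euclidean topology, and no metric notion below depends on the choice of
   norm. Manifolds are embedded submanifolds, given as subsets of 'rV[R]_n.
   A map defined only on a subset (a manifold, a tangent space, a chart domain)
   is a total function whose values outside that subset are irrelevant, and a
   map indexed by a base point takes the base point as its first argument. *)

Section Regularity.
Variables (R : realType) (V W : normedModType R).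

(* On an open subset of a finite-dimensional space, f is C^(k+1) iff it is
   differentiable and all its directional derivatives are C^k. *)
Fixpoint Ck_open (k : nat) (U : set V) (f : V -> W) : Prop :=
  if k is k'.+1 then
    (forall x, U x -> differentiable f x) /\
    (forall v : V, Ck_open k' U ('D_v f))
  else forall x, U x -> {for x, continuous f}.

Definition smooth_open (U : set V) (f : V -> W) : Prop :=
  forall k, Ck_open k U f.

(* A map on an arbitrary subset A has a given regularity when, near every point
   of A, it is the restriction of a map of that regularity on an open set. For
   A an embedded submanifold this is the usual regularity in charts. *)
Definition locally_extends (reg : set V -> (V -> W) -> Prop)
    (A : set V) (f : V -> W) : Prop :=
  forall a, A a -> exists (U : set V) (F : V -> W),
    [/\ open U, U a, reg U F & forall z, A z -> U z -> F z = f z].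

Definition C1_on := locally_extends (Ck_open 1).
Definition smooth_on := locally_extends smooth_open.

Definition rel_open (A B : set V) : Prop := exists2 O, open O & B = A `&` O.

End Regularity.

Section Manifolds.
Variables (R : realType) (n : nat).
Local Notation V := 'rV[R]_n.
Implicit Types (M : set V) (p u v w : V).

Definition slice (d : nat) : set V :=
  [set u | forall i : 'I_n, (d <= i)%N -> u 0 i = 0].

Definition embedded_submanifold (d : nat) M : Prop :=
  (d <= n)%N /\
  forall p, M p -> exists (U U' : set V) (phi psi : V -> V),
    [/\ open U /\ U p, open U',
        [/\ set_fun U U' phi, set_fun U' U psi,
            (forall z, U z -> psi (phi z) = z) &
            (forall z, U' z -> phi (psi z) = z)],
        smooth_open U phi /\ smooth_open U' psi &
        phi @` (M `&` U) = U' `&` slice d].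

Definition smooth_curve M p v (c : R -> V) : Prop :=
  exists I : set R,
    [/\ open I /\ I 0, smooth_open I c, (forall t, I t -> M (c t)),
        c 0 = p & is_derive (0 : R) (1 : R) c v].

Definition tangent M p : set V := [set v | exists c, smooth_curve M p v c].

(* [mdiff M F p v w]: the differential at p of the map F on M sends the tangent
   vector v to w. *)
Definition mdiff (W : normedModType R) M (F : V -> W) p v (w : W) : Prop :=
  forall c, smooth_curve M p v c -> is_derive (0 : R) (1 : R) (F \o c) w.

Definition vector_field M (X : V -> V) : Prop :=
  forall p, M p -> tangent M p (X p).

Record riemannian_metric M (g : V -> V -> V -> R) : Prop := {
  metric_linear : forall p, M p -> forall (a : R) u v w,
    tangent M p u -> tangent M p v -> tangent M p w ->
    g p (a *: u + v) w = a * g p u w + g p v w ;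
  metric_sym : forall p, M p -> forall u v,
    tangent M p u -> tangent M p v -> g p u v = g p v u ;
  metric_pos : forall p, M p -> forall u,
    tangent M p u -> u != 0 -> 0 < g p u u ;
  metric_smooth : forall X Y : V -> V,
    vector_field M X -> vector_field M Y -> smooth_on M X -> smooth_on M Y ->
    smooth_on M (fun p => g p (X p) (Y p))
}.

Definition riemannian_manifold (d : nat) M (g : V -> V -> V -> R) : Prop :=
  embedded_submanifold d M /\ riemannian_metric M g.

Definition is_rgrad M (g : V -> V -> V -> R) (f : V -> R) p (G : V) : Prop :=
  tangent M p G /\ forall v, tangent M p v -> mdiff M f p v (g p G v).

Definition rgrad M (g : V -> V -> V -> R) (f : V -> R) p : V :=
  xget 0 [set G | is_rgrad M g f p G].

(* The last field says that the differential of Rt p at 0, as a map on the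
   manifold T_pM, is the identity. *)
Record retraction M (Rt : V -> V -> V) : Prop := {
  retr_fun : forall p, M p -> set_fun (tangent M p) M (Rt p) ;
  retr_smooth : forall p, M p -> smooth_on (tangent M p) (Rt p) ;
  retr_center : forall p, M p -> Rt p 0 = p ;
  retr_diff : forall p, M p -> forall v, tangent M p v ->
    mdiff (tangent M p) (Rt p) 0 v v
}.

(* [U p] is the domain of the lifting map [L p]. *)
Definition lifting M (Rt : V -> V -> V) (U : V -> set V) (L : V -> V -> V)
    : Prop :=
  forall p, M p -> exists O : set V,
    [/\ rel_open (tangent M p) O /\ O 0,
        rel_open M (U p) /\ U p p,
        Rt p @` O = U p,
        forall v, O v -> L p (Rt p v) = v &
        smooth_on (U p) (L p)].

Definition Rconvex_set M (Rt : V -> V -> V) (U : V -> set V) (L : V -> V -> V)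
    (C : set V) : Prop :=
  C `<=` M /\ forall a b, C a -> C b ->
    U a b /\ forall t : R, 0 <= t <= 1 -> C (Rt a (t *: L a b)).

Definition Rconvex_fun (Rt L : V -> V -> V) (C : set V) (f : V -> R) : Prop :=
  forall a b, C a -> C b ->
    convex_function (`[0, 1]%classic : set R^o)
      (fun t : R^o => f (Rt a (t *: L a b))).

End Manifolds.

Section Transfer.
Variables (R : realType) (m n : nat).
Implicit Types (S : set 'rV[R]_m) (T : set 'rV[R]_n).

Definition linear_between S T (f : 'rV[R]_m -> 'rV[R]_n) : Prop :=
  set_fun S T f /\
  forall (a : R) u v, S u -> S v -> f (a *: u + v) = a *: f u + f v.

Definition vector_prolongation S T (P : 'rV[R]_m -> 'rV[R]_n) : Prop :=
  linear_between S T P /\ set_inj S P.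

Definition vector_restriction S T (Q : 'rV[R]_m -> 'rV[R]_n) : Prop :=
  linear_between S T Q /\ set_surj S T Q.

End Transfer.

Definition coarse_objective (R : realType) (n : nat)
    (g : 'rV[R]_n -> 'rV[R]_n -> 'rV[R]_n -> R)
    (L : 'rV[R]_n -> 'rV[R]_n -> 'rV[R]_n)
    (f : 'rV[R]_n -> R) (y w z : 'rV[R]_n) : R :=
  f z - g y w (L y z).

(* Main.v *)
Require Import Defs.
From HB Require Import structures.
From mathcomp Require Import all_boot all_order all_algebra.
From mathcomp Require Import all_classical all_reals.
From mathcomp Require Import interval_inference topology normedtype derive convex.
From mathcomp Require Import lra.

Set Implicit Arguments.
Unset Strict Implicit.
Unset Printing Implicit Defensive.
Import Order.TTheory GRing.Theory Num.Theory.
Import numFieldNormedType.Exports.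
Local Open Scope classical_set_scope.
Local Open Scope ring_scope.

(** Write v for the lift of zt, so that zt = Rt y v. Along the retraction curve
    t |-> Rt y (t *: v) the objective fH is convex on [0, 1], hence its slope
    at t = 0 is at most its increment over [0, 1]. The curve leaves y with
    velocity v, so this slope is the inner product of grad fH y with v:

      < grad fH y, v >_y <= fH zt - fH y.

    Subtracting < w, v >_y from both sides turns the right-hand side into
    q zt - q y, because the lift of y is 0. On the left, the first-order
    correction in w was designed so that grad fH y - w is the restriction of
    grad fh x, and the Galerkin condition moves the restriction to the other
    side of the inner product, where it becomes the prolongation d of v.

    The analytic content is that grad fH y exists, the gradient being defined
    by choice with default value 0. In a slice chart the tangent space is the
    image of a linear map (tangent_row_space), hence a finite-dimensional
    vector space, on which the differential of fH is represented by the metric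
    (riesz_row_space); this gives rgradP. The other two ingredients are that
    retraction curves are smooth curves with the expected velocity
    (smooth_curve_retraction) and that a convex function lies below its chord
    (convex_derive_le_chord). *)

(** * Calculus along lines and curves *)

Lemma derive_comp (R : realType) (V1 V2 W : normedModType R)
    (g : V1 -> V2) (f : V2 -> W) x v :
  differentiable g x -> differentiable f (g x) ->
  'D_v (f \o g) x = 'd f (g x) ('D_v g x).
Proof.
move=> dg df; rewrite deriveE; last exact: differentiable_comp.
by rewrite diff_comp// (deriveE _ dg).
Qed.

Section Lines.
Variables (R : realType) (V W : normedModType R).

Definition line (a u : V) (t : R) : V := a + t *: u.

Lemma is_diff_line (a u : V) t : is_diff t (line a u) (fun h => h *: u).
Proof.
have -> : line a u = cst a + (fun t => t *: u) by [].
by apply: is_diff_eq; rewrite add0r.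
Qed.

Lemma differentiable_line (a u : V) t : differentiable (line a u) t.
Proof. by have [] := is_diff_line a u t. Qed.

Lemma derive_line (a u : V) t h : 'D_h (line a u) t = h *: u.
Proof. by rewrite deriveE//; have [_ ->] := is_diff_line a u t. Qed.

(** The chain rule in terms of velocities, the form in which tangent vectors are
    defined. *)
Lemma is_derive_comp_curve (c : R -> V) (F : V -> W) t v :
  is_derive t (1 : R) c v -> differentiable F (c t) ->
  is_derive t (1 : R) (F \o c) ('d F (c t) v).
Proof.
move=> [dc cv] dF; have dc' : differentiable c t by apply/derivable1_diffP.
have dFc : differentiable (F \o c) t by exact: differentiable_comp.
apply: DeriveDef; first by apply/derivable1_diffP.
by rewrite derive_comp// cv.
Qed.

Lemma is_derive_line (a u : V) t : is_derive t (1 : R) (line a u) u.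
Proof.
have dl := differentiable_line a u t.
apply: DeriveDef; first by apply/derivable1_diffP.
by rewrite derive_line scale1r.
Qed.

Lemma open_preimage_line (a u : V) (U : set V) :
  open U -> open (line a u @^-1` U).
Proof.
move=> oU; apply: open_comp => // t _.
exact/differentiable_continuous/differentiable_line.
Qed.

End Lines.

(** * Smoothness of curves *)

Section Smoothness.
Variables (R : realType).

(** Regularity on an open set is local. The source is the real line, where
    differentiability is the existence of a one-variable derivative, which only
    depends on germs. *)
Lemma Ck_open_eq (W : normedModType R) k (U : set R) (f g : R -> W) :
  open U -> (forall x, U x -> f x = g x) -> Ck_open k U f -> Ck_open k U g.
Proof.
move=> oU; elim: k f g => [|k IH] f g fg /=.
  move=> cf x Ux; have nfg : \near x, f x = g x.
    by near=> z; apply: fg; near: z; apply: open_nbhs_nbhs.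
  have := cf _ Ux; rewrite /prop_for /continuous_at fg//.
  by apply: cvg_trans; exact: near_eq_cvg.
have nfg x : U x -> \near x, f x = g x.
  by move=> Ux; near=> z; apply: fg; near: z; apply: open_nbhs_nbhs.
move=> [df Cf]; split=> [x Ux|v].
  apply/derivable1_diffP/(near_eq_derivable (nfg _ Ux)).
  exact/derivable1_diffP/df.
apply: IH (Cf v) => x Ux; exact: near_eq_derive (nfg _ Ux).
Unshelve. all: by end_near. Qed.

(** The derivative in the direction h of f restricted to a line is the
    restriction to that line of the derivative of f in the direction h *: u,
    so the induction on k stays within restrictions to the same line. *)
Lemma Ck_open_line (V W : normedModType R) k (U : set V) (f : V -> W) a u :
  open U -> Ck_open k U f -> Ck_open k (line a u @^-1` U) (f \o line a u).
Proof.
move=> oU; elim: k f => [|k IH] f /=.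
  move=> cf t Ut; apply: continuous_comp; last exact: cf.
  exact/differentiable_continuous/differentiable_line.
move=> [df Cf]; split=> [t Ut|h].
  by apply: differentiable_comp (df _ Ut); exact: differentiable_line.
apply: Ck_open_eq (IH _ (Cf (h *: u))); first exact: open_preimage_line.
move=> t Ut /=; have dt := df _ Ut; have dl := differentiable_line a u t.
by rewrite (deriveE _ dt) (derive_comp _ dl dt) derive_line.
Qed.

Lemma smooth_open_cst (V W : normedModType R) (U : set V) (b : W) :
  smooth_open U (cst b).
Proof.
move=> k; elim: k b => [|k IH] b /=; first by move=> x _; exact: cvg_cst.
split=> [x _|v]; first exact: differentiable_cst.
by rewrite (_ : 'D_v _ = cst 0) //; apply/funext => x; rewrite derive_cst.
Qed.

Lemma smooth_open_line (V : normedModType R) (a u : V) (I : set R) :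
  smooth_open I (line a u).
Proof.
case=> [|k] /=; first by
  move=> t _; exact/differentiable_continuous/differentiable_line.
split=> [t _|h]; first exact: differentiable_line.
rewrite (_ : 'D_h _ = cst (h *: u)); first exact: smooth_open_cst.
by apply/funext => t; rewrite derive_line.
Qed.

End Smoothness.

(** * Tangent spaces of embedded submanifolds *)

Section Tangent.
Variables (R : realType) (n d : nat).
Implicit Types (M U : set 'rV[R]_n) (p v s : 'rV[R]_n) (c : R -> 'rV[R]_n).

Definition slice_proj : 'M[R]_n := diag_mx (\row_(i < n) (i < d)%N%:R).

Lemma slice_slice_proj s : slice d (s *m slice_proj).
Proof. by rewrite mul_mx_diag => i di; rewrite !mxE ltnNge di mulr0. Qed.

Lemma slice_proj_id s : slice d s -> s *m slice_proj = s.
Proof.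
move=> ss; rewrite mul_mx_diag; apply/rowP => i; rewrite !mxE.
by case: ltnP => [|di]; rewrite ?mulr1// mulr0 ss.
Qed.

Lemma smooth_curve_near M U p v c :
  open U -> U p -> smooth_curve M p v c ->
  \forall t \near (0 : R), (M `&` U) (c t).
Proof.
move=> oU Up [I [[oI I0] sc Mc c0 _]].
have [cc _] := sc 1%N; have /differentiable_continuous cont0 := cc _ I0.
near=> t; split; first by apply: Mc; near: t; exact: open_nbhs_nbhs.
near: t; apply: cont0; rewrite c0; exact: open_nbhs_nbhs.
Unshelve. all: by end_near. Qed.

Lemma slice_is_derive c s :
  (\forall t \near (0 : R), slice d (c t)) ->
  is_derive (0 : R) (1 : R) c s -> slice d s.
Proof.
move=> sc [dc <-] i di; rewrite derive_mx// mxE.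
rewrite (@near_eq_derive _ _ _ _ (cst 0)) ?derive_cst//.
near=> t; have st : slice d (c t) by near: t.
exact: st.
Unshelve. all: by end_near. Qed.

(** In a chart phi with inverse psi, the tangent space at p is the image of the
    slice under the differential of psi at phi p: a curve in M is carried by phi
    to a curve in the slice, whose velocity stays in the slice, and conversely
    psi carries straight lines of the slice to curves in M. *)
Lemma tangent_row_space M p : embedded_submanifold d M -> M p ->
  exists B : 'M[R]_n, forall v, tangent M p v <-> (v <= B)%MS.
Proof.
move=> [_ hM] Mp; have [U [U' [phi [psi]]]] := hM _ Mp.
move=> [[oU Up] oU' [fphi fpsi psiK phiK] [sphi spsi] img].
have [dphi _] := sphi 1%N; have [dpsi _] := spsi 1%N.
have img_of z : M z -> U z -> (U' `&` slice d) (phi z).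
  by move=> Mz Uz; rewrite -img; exists z.
have [U'a sa] := img_of _ Mp Up; set a := phi p in U'a sa.
exists (slice_proj *m lin1_mx ('d psi a)) => v; split.
  move=> [c cv]; have [I [[oI I0] sc Mc c0 dc]] := cv.
  have near0 := smooth_curve_near oU Up cv.
  have dpc : is_derive (0 : R) (1 : R) (phi \o c) ('d phi p v).
    by rewrite -c0; apply: is_derive_comp_curve => //; rewrite c0; exact: dphi.
  have ss : slice d ('d phi p v).
    apply: slice_is_derive dpc; near=> t.
    have [Mt Ut] : (M `&` U) (c t) by near: t.
    by have [] := img_of _ Mt Ut.
  apply/submxP; exists ('d phi p v); rewrite mulmxA slice_proj_id// mul_rV_lin1.
  have dppc :
      is_derive (0 : R) (1 : R) (psi \o (phi \o c)) ('d psi a ('d phi p v)).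
    have ea : (phi \o c) 0 = a by rewrite /= c0.
    by rewrite -ea; apply: is_derive_comp_curve dpc _; rewrite ea; exact: dpsi.
  have : is_derive (0 : R) (1 : R) c ('d psi a ('d phi p v)).
    apply: near_eq_is_derive dppc; near=> t; rewrite /= psiK//.
    by have [] : (M `&` U) (c t) by near: t.
  by case: dc => _ <- [_ <-].
move=> /submxP[s ->]; rewrite mulmxA mul_rV_lin1.
(* the image under psi of the line through phi p directed by r *)
set r := s *m slice_proj; exists (psi \o line a r), (line a r @^-1` U').
have l0 : line a r 0 = a by rewrite /line scale0r addr0.
split.
- by split; [exact: open_preimage_line|rewrite /= l0].
- by move=> k; apply: Ck_open_line => //; exact: spsi.
- move=> t U't; have : (U' `&` slice d) (line a r t).
    split=> // i di; have /(_ i di) ri := slice_slice_proj s.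
    by rewrite /line mxE [X in _ + X]mxE sa// ri mulr0 addr0.
  by rewrite -img => -[z [Mz Uz] zE]; rewrite /= -zE psiK.
- by rewrite /= l0 psiK.
rewrite -[in 'd psi a r]l0; apply: is_derive_comp_curve.
  exact: is_derive_line.
by rewrite l0; exact: dpsi.
Unshelve. all: by end_near. Qed.

Lemma tangent_linear_comb M p (a : R) u v : embedded_submanifold d M -> M p ->
  tangent M p u -> tangent M p v -> tangent M p (a *: u + v).
Proof.
move=> hM Mp; have [B BP] := tangent_row_space hM Mp.
by rewrite !BP => uB vB; rewrite addmx_sub ?scalemx_sub.
Qed.

Lemma tangent0 M p : M p -> tangent M p 0.
Proof.
move=> Mp; exists (cst p), setT; split=> //; first by split=> //; exact: openT.
  exact: smooth_open_cst.
exact: is_derive_cst.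
Qed.

End Tangent.

(** * Riesz representation on a subspace *)

Section Riesz.
Variables (R : realFieldType) (n : nat).

Lemma linear_on_lincomb m (b : 'M[R]_(m, n)) (h : 'rV[R]_n -> R) :
  (forall a u v, (u <= b)%MS -> (v <= b)%MS ->
     h (a *: u + v) = a * h u + h v) ->
  forall c : 'rV[R]_m, h (c *m b) = \sum_i c 0 i * h (row i b).
Proof.
move=> hl c; have h0 : h 0 = 0.
  have := hl 1 0 0 (sub0mx _ _) (sub0mx _ _).
  by rewrite scaler0 addr0 mul1r -[LHS]addr0 => /addrI/esym.
rewrite mulmx_sum_row; elim: (index_enum _) => [|i r IH].
  by rewrite !big_nil.
rewrite !big_cons hl ?IH//; first exact: row_sub.
by apply: summx_sub => j _; rewrite scalemx_sub// row_sub.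
Qed.

(** The Gram matrix of a basis of the subspace is invertible by positivity, so
    the coordinates of the representing vector solve a linear system. The form g
    is constrained on the subspace only, since a Riemannian metric at a point is
    only meaningful on tangent vectors. *)
Lemma riesz_row_space (B : 'M[R]_n) (g : 'rV[R]_n -> 'rV[R]_n -> R)
    (l : {linear 'rV[R]_n -> R}) :
  (forall a u v w, (u <= B)%MS -> (v <= B)%MS -> (w <= B)%MS ->
     g (a *: u + v) w = a * g u w + g v w) ->
  (forall u v, (u <= B)%MS -> (v <= B)%MS -> g u v = g v u) ->
  (forall u, (u <= B)%MS -> u != 0 -> 0 < g u u) ->
  exists2 G, (G <= B)%MS & forall v, (v <= B)%MS -> l v = g G v.
Proof.
move=> glin gsym gpos; pose b := row_base B.
have bB u : (u <= b)%MS = (u <= B)%MS by rewrite eq_row_base.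
have cbB (c : 'rV_(\rank B)) : (c *m b <= B)%MS by rewrite -bB submxMl.
have rowB i : (row i b <= B)%MS by rewrite -bB row_sub.
have gE c w : (w <= B)%MS -> g (c *m b) w = \sum_i c 0 i * g (row i b) w.
  move=> wB; apply: (@linear_on_lincomb _ b (g^~ w)) => a u v ub vb.
  by apply: glin; rewrite // -bB.
pose K := \matrix_(i, j) g (row i b) (row j b).
have cK (c : 'rV_(\rank B)) j : (c *m K) 0 j = g (c *m b) (row j b).
  by rewrite gE// mxE; apply: eq_bigr => i _; rewrite mxE.
have Kunit : K \in unitmx.
  rewrite -row_free_unit; apply: inj_row_free => c cK0.
  have gcb0 : g (c *m b) (c *m b) = 0.
    rewrite gE// big1// => i _; rewrite gsym// -cK cK0 mxE mulr0//.
  have /eqP cb0 : c *m b == 0.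
    by apply: contraTT isT => /(gpos _ (cbB c)); rewrite gcb0 ltxx.
  by apply: (row_free_inj (row_base_free B)); rewrite cb0 mul0mx.
pose c := (\row_j l (row j b)) *m invmx K.
exists (c *m b) => // v; rewrite -bB => /submxP[e ->].
rewrite gsym// gE// (linear_on_lincomb (b := b) (h := l)).
  by apply: eq_bigr => j _; rewrite gsym// -cK mulmxKV// mxE.
by move=> a u w _ _; rewrite linearP.
Qed.

End Riesz.

(** * Riemannian gradients and retraction curves *)

Section Gradient.
Variables (R : realType) (n d : nat).
Implicit Types (M : set 'rV[R]_n) (g : 'rV[R]_n -> 'rV[R]_n -> 'rV[R]_n -> R).

(** The default value 0 of the gradient is a tangent vector too. *)
Lemma rgrad_tangent M g f p : M p -> tangent M p (rgrad M g f p).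
Proof.
by move=> Mp; rewrite /rgrad; case: xgetP => [G _ []//|_]; exact: tangent0.
Qed.

(** Near p, f is the restriction of a C^1 function F of the ambient space; the
    Riesz representative of the differential of F is a gradient of f. *)
Lemma rgradP M g f p : riemannian_manifold d M g -> C1_on M f -> M p ->
  is_rgrad M g f p (rgrad M g f p).
Proof.
move=> [hM hg] f1 Mp; apply: xgetPex.
have [B BP] := tangent_row_space hM Mp.
have [U [F [oU Up [dF _] Ff]]] := f1 _ Mp.
have [a u v w|u v|u|G GB lG] := @riesz_row_space _ _ B (g p) ('d F p).
- by move=> /BP Tu /BP Tv /BP Tw; exact: (metric_linear hg Mp).
- by move=> /BP Tu /BP Tv; exact: (Defs.metric_sym hg Mp).
- by move=> /BP Tu; exact: (metric_pos hg Mp).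
exists G; split; first exact/BP.
move=> v /BP vB c cv; have [_ [_ _ _ c0 dc]] := cv.
rewrite -lG//; have near0 := smooth_curve_near oU Up cv.
have dFc : is_derive (0 : R) (1 : R) (F \o c) ('d F p v).
  by rewrite -c0; apply: is_derive_comp_curve => //; rewrite c0; exact: dF.
apply: near_eq_is_derive dFc; near=> t.
by have [Mt Ut] : (M `&` U) (c t) by [near: t]; rewrite /= Ff.
Unshelve. all: by end_near. Qed.

(** The differential of Rt p at 0 being the identity, the image of the line
    directed by v in the tangent space has velocity v. *)
Lemma smooth_curve_retraction M Rt p v : retraction M Rt -> M p ->
  (forall t : R, tangent M p (t *: v)) ->
  smooth_curve M p v (fun t => Rt p (t *: v)).
Proof.
move=> hRt Mp ttv; have tv : tangent M p v by have := ttv 1; rewrite scale1r.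
have lE : (fun t => Rt p (t *: v)) = Rt p \o line 0 v.
  by apply/funext => t; rewrite /= /line add0r.
have tl t : tangent M p (line 0 v t) by rewrite /line add0r.
have l0 : line 0 v 0 = 0 :> 'rV[R]_n by rewrite /line scale0r addr0.
have [U [F [oU U0 sF FRt]]] := retr_smooth hRt Mp (tangent0 Mp).
rewrite lE; exists (line 0 v @^-1` U); split.
- by split; [exact: open_preimage_line|rewrite /= l0].
- move=> k; apply: Ck_open_eq (Ck_open_line 0 v oU (sF k)).
    exact: open_preimage_line.
  by move=> t Ut /=; exact: FRt.
- by move=> t _; exact: (retr_fun hRt Mp (tl t)).
- by rewrite /= l0 (retr_center hRt Mp).
apply: (retr_diff hRt Mp tv); exists setT; split => //.
- by split=> //; exact: openT.
- exact: smooth_open_line.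
- exact: is_derive_line.
Qed.

End Gradient.

(** * Convexity and descent *)

(** The difference quotients of f at 0 are at most the slope of the chord, by
    convexity; let their step decrease to 0. *)
Lemma convex_derive_le_chord (R : realType) (f : R -> R) l :
  convex_function (`[0, 1]%classic : set R^o) (f : R^o -> R^o) ->
  is_derive (0 : R) (1 : R) f l -> l <= f 1 - f 0.
Proof.
move=> cf [df <-].
(* Convexity on [0, 1] controls the difference quotients for positive h only. *)
rewrite ['D_1 f 0]cvg_at_rightE; last exact: df.
apply: limr_le.
  rewrite -(cvg_at_rightE (fun h : R => h^-1 *: ((f \o shift 0) _ - f 0))) //.
  apply: cvg_trans df; apply: cvg_app.
  move=> A [e egt0 Ae]; exists e => // x xe xgt0; apply: Ae => //.
  exact/lt0r_neq0.
near=> h.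
have h0 : 0 < h by near: h; exact: nbhs_right_gt.
have h1 : h <= 1 by near: h; exact: nbhs_right_le.
have := cf (Itv01 (ltW h0) h1) 1 0.
rewrite !inE /= !in_itv /= !lexx !ler01 => /(_ isT isT).
rewrite !convRE /= /conv /= scaler0 !addr0 [h%:A]mulr1 /unstable.onem => fh.
rewrite -[_ *: _]/(_ * _) mulrC ler_pdivrMr//; lra.
Unshelve. all: by end_near. Qed.

Theorem proposition3p3 (R : realType) (nH nh dH dh : nat)
  (MH : set 'rV[R]_nH) (gH : 'rV[R]_nH -> 'rV[R]_nH -> 'rV[R]_nH -> R)
  (hMH : riemannian_manifold dH MH gH)
  (Mh : set 'rV[R]_nh) (gh : 'rV[R]_nh -> 'rV[R]_nh -> 'rV[R]_nh -> R)
  (hMh : riemannian_manifold dh Mh gh)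
  (fH : 'rV[R]_nH -> R) (hfH : C1_on MH fH)
  (fh : 'rV[R]_nh -> R) (hfh : C1_on Mh fh)
  (RtH : 'rV[R]_nH -> 'rV[R]_nH -> 'rV[R]_nH) (hRtH : retraction MH RtH)
  (UH : 'rV[R]_nH -> set 'rV[R]_nH)
  (LH : 'rV[R]_nH -> 'rV[R]_nH -> 'rV[R]_nH) (hLH : lifting MH RtH UH LH)
  (x : 'rV[R]_nh) (hx : Mh x) (y : 'rV[R]_nH) (hy : MH y)
  (Pyx : 'rV[R]_nH -> 'rV[R]_nh) (Rxy : 'rV[R]_nh -> 'rV[R]_nH)
  (hP : vector_prolongation (tangent MH y) (tangent Mh x) Pyx)
  (hR : vector_restriction (tangent Mh x) (tangent MH y) Rxy)
  (hGalerkin : forall u v, tangent MH y u -> tangent Mh x v ->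
     gh x (Pyx u) v = gH y u (Rxy v))
  (Cy : set 'rV[R]_nH) (hCy : Rconvex_set MH RtH UH LH Cy)
  (hyCy : Cy y) (hCyU : Cy `<=` UH y) :
  let w := rgrad MH gH fH y - Rxy (rgrad Mh gh fh x) in
  let q := coarse_objective gH LH fH y w in
  forall zt : 'rV[R]_nH, Cy zt -> q zt < q y ->
  let d := Pyx (LH y zt) in
  Rconvex_fun RtH LH Cy fH ->
  gh x (rgrad Mh gh fh x) d <= q zt - q y /\ q zt - q y < 0.
Proof.
move=> w q zt Czt qlt d cvx; split; last by rewrite subr_lt0.
have [hM gM] := hMH; have [_ gm] := hMh.
have T0 := tangent0 hy.
have Tcomb a u v := @tangent_linear_comb _ _ _ _ _ a u v hM hy.
have [O [[[O' _ OE] O0] _ img LK _]] := hLH _ hy.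
have : (RtH y @` O) zt by rewrite img; exact: hCyU.
move=> [v Ov vzt]; have Lzt : LH y zt = v by rewrite -vzt LK.
have Ly : LH y y = 0 by have := LK _ O0; rewrite (retr_center hRtH hy).
have Tv : tangent MH y v by move: Ov; rewrite OE => -[].
have Ttv t : tangent MH y (t *: v) by rewrite -[_ *: _]addr0; exact: Tcomb.
have [TG gradG] := rgradP hMH hfH hy; have Tr := rgrad_tangent gh fh hx.
set G := rgrad MH gH fH y in w q qlt TG gradG *.
set r := rgrad Mh gh fh x in w q qlt Tr *.
have [[RT _] _] := hR; have [[PT _] _] := hP.
have TR : tangent MH y (Rxy r) by exact: RT.
have chord : gH y G v <= fH zt - fH y.
  have := gradG _ Tv _ (smooth_curve_retraction hRtH hy Ttv).
  have := cvx _ _ hyCy Czt; rewrite Lzt => cf df.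
  have := convex_derive_le_chord cf df.
  by rewrite /= scale1r scale0r vzt (retr_center hRtH hy).
have gw u : tangent MH y u -> gH y w u = gH y G u - gH y (Rxy r) u.
  move=> Tu; rewrite /w addrC -scaleN1r (metric_linear gM hy)//.
  by rewrite mulN1r addrC.
have g0 u : tangent MH y u -> gH y u 0 = 0.
  move=> Tu; rewrite (Defs.metric_sym gM hy)//.
  have := metric_linear gM hy 1 T0 T0 Tu.
  by rewrite scaler0 addr0 mul1r -[LHS]addr0 => /addrI/esym.
rewrite /q /coarse_objective /d Lzt Ly !gw// !g0//.
rewrite (Defs.metric_sym gm hx)//; last exact: PT.
rewrite hGalerkin// (Defs.metric_sym gM hy)//; lra.
Qed.
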